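(* Let $AA_1$, $BB_1$, $CC_1$ be three cevians of a triangle $\triangle ABC$ mutually meeting at the points $X_1 = BB_1 \cap CC_1$, $Y_1 = AA_1 \cap CC_1$, $Z_1 = AA_1 \cap BB_1$. Let $AA_2$, $BB_2$, $CC_2$ be another triple of cevians of $\triangle ABC$, mutually meeting at the points $X_2 = BB_2 \cap CC_2$, $Y_2 = AA_2 \cap CC_2$, $Z_2 = AA_2 \cap BB_2$. Put $U_1 := BB_1 \cap CC_2$, $V_1 := CC_1 \cap AA_2$, and $W_1 := AA_1 \cap BB_2$. Then the following conditions are equivalent: (1) $A_1, A_2, B_1, B_2, C_1, C_2$ lie on a single conic $\mathcal C_0$; (2) $X_1, X_2, Y_1, Y_2, Z_1, Z_2$ lie on a single conic $\mathcal C_1$; (3) the lines $AA_1, AA_2, BB_1, BB_2, CC_1, CC_2$ touch the same conic $\mathcal C_2$; (4) the lines $AU_1$, $BV_1$, $CW_1$ intersect in a single point.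
   Context: The setting is the projective plane, i.e. the Euclidean plane completed by the line at infinity, so that intersection points may be points at infinity. A cevian of a triangle is a ray from a vertex of the triangle through a point on the opposite side (or its continuation); $AA_i$, $BB_i$, $CC_i$ ($i=1,2$) denote cevians with $A_i$ on line $BC$, $B_i$ on line $CA$, $C_i$ on line $AB$, and in incidence and tangency statements they are regarded as full lines. A line touches a conic if it is tangent to it. Five distinct points (or lines) in general position determine a unique non-degenerate conic passing through (respectively, touching) them; when three or more of the points are collinear (respectively, three or more of the lines are concurrent), the conic may degenerate and may fail to be unique.
   Formalization: Assumes no cevian is a side, A1≠A2, B1≠B2, C1≠C2, and that both triples are concurrent or neither is: if only one is, (2) always holds while (1), (3), (4) fail. Conics may degenerate; in (3) to a pair of points. *)

(* Defs.v *)
From HB Require Import structures.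
From mathcomp Require Import all_boot all_order all_algebra.
Set Implicit Arguments.
Unset Strict Implicit.
Unset Printing Implicit Defensive.
Import GRing.Theory.
Local Open Scope ring_scope.

(* The projective plane over F is the set of one-dimensional subspaces of F^3;
   its lines are the two-dimensional subspaces, and incidence is inclusion.
   With F the reals, the Euclidean point (x, y) is <[(x, y, 1)]>, and the line
   at infinity consists of the points <[(x, y, 0)]>. *)
Record point (F : fieldType) := Point {
  point_space :> {vspace 'rV[F]_3};
  _ : \dim point_space == 1%N }.
HB.instance Definition _ (F : fieldType) := [isSub for @point_space F].
HB.instance Definition _ (F : fieldType) := [Equality of point F by <:].

(* A line when P and Q are distinct. *)
Definition line (F : fieldType) (P Q : point F) : {vspace 'rV[F]_3} :=
  (P + Q)%VS.

Definition on_line (F : fieldType) (P : point F) (L : {vspace 'rV[F]_3}) : Prop :=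
  (P <= L)%VS.

Definition is_intersection (F : fieldType) (P : point F)
    (L M : {vspace 'rV[F]_3}) : Prop :=
  point_space P = (L :&: M)%VS.

Definition triangle (F : fieldType) (A B C : point F) : Prop :=
  (A + B + C)%VS = fullv.

(* P is the foot, on the side line QR, of a cevian issued from the vertex
   opposite to QR; a cevian is not a side, so P is neither Q nor R. *)
Definition cevian_foot (F : fieldType) (Q R P : point F) : Prop :=
  [/\ on_line P (line Q R), P <> Q & P <> R].

Definition concurrent (F : fieldType) (L M N : {vspace 'rV[F]_3}) : Prop :=
  exists P : point F, [/\ on_line P L, on_line P M & on_line P N].

Definition meet_in_single_point (F : fieldType)
    (L M N : {vspace 'rV[F]_3}) : Prop :=
  exists! P : point F, [/\ on_line P L, on_line P M & on_line P N].

(* Q is the Gram matrix of the equation v Q v^T = 0 of a conic, which may be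
   degenerate (a pair of lines or a double line). *)
Definition conic (F : fieldType) (Q : 'M[F]_3) : Prop := Q^T = Q /\ Q != 0.

Definition nondegenerate_conic (F : fieldType) (Q : 'M[F]_3) : Prop :=
  Q^T = Q /\ Q \in unitmx.

Definition on_conic (F : fieldType) (Q : 'M[F]_3) (P : point F) : Prop :=
  forall v, v \in point_space P -> v *m Q *m v^T = 0.

(* Tangency to a nondegenerate conic: exactly one common point. *)
Definition tangent (F : fieldType) (Q : 'M[F]_3) (L : {vspace 'rV[F]_3}) : Prop :=
  exists! P : point F, on_line P L /\ on_conic Q P.

Definition lie_on_conic (F : fieldType) (s : seq (point F)) : Prop :=
  exists2 Q : 'M[F]_3, conic Q & forall P, P \in s -> on_conic Q P.

(* Just as a conic through points may degenerate to two lines when three of the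
   points are collinear, a conic touched by lines may degenerate to two points
   when three of the lines are concurrent: the projective dual of a pair of
   lines is a pair of points, and the lines touching the latter are those
   through one of the two points. *)
Definition touch_conic (F : fieldType) (s : seq {vspace 'rV[F]_3}) : Prop :=
  (exists2 Q : 'M[F]_3, nondegenerate_conic Q &
     forall L, L \in s -> tangent Q L)
  \/ (exists P P' : point F, forall L, L \in s -> on_line P L \/ on_line P' L).

(* Main.v *)
Require Import Defs.
From HB Require Import structures.
From mathcomp Require Import all_boot all_order all_algebra.
From mathcomp Require Import ring.
From mathcomp Require Import reals.
Set Implicit Arguments.
Unset Strict Implicit.
Unset Printing Implicit Defensive.
Import GRing.Theory Num.Theory.
Local Open Scope ring_scope.

(* In homogeneous coordinates with A, B, C as base points write
   A_i = (0 : a_i : 1), B_i = (1 : 0 : b_i), C_i = (c_i : 1 : 0).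
   Each of the four conditions says that a1 a2 b1 b2 c1 c2 = 1.
   For (1) this is Carnot's theorem, by Vieta on each side of the triangle; (3) is
   Carnot's theorem for the dual conic, and when the dual conic is singular its
   determinant factors so that the six lines split into two concurrent triples.
   For (2), writing conics through X1, Y1, Z1 as
   alpha m n + beta n l + gamma l m = 0 leaves a 3 x 3 linear system whose
   determinant is, up to factors excluded by the hypotheses,
   a1 a2 b1 b2 c1 c2 - 1.  If both triples are concurrent the product is 1 anyway.
   For (4) it is a Ceva-type computation. *)

(** * Homogeneous coordinates of points and lines in a projective frame *)

Definition at_coords (F : fieldType) (T : 'M[F]_3) (P : point F) (x : 'rV[F]_3) :=
  x != 0 /\ point_space P = <[x *m T]>%VS.

(** The rows of [T] are the base vectors, so [x *m T] is the vector with coordinates [x], and the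
    row [l] holds the line coordinates of [L]. *)
Definition has_equation (F : fieldType) (T : 'M[F]_3) (L : {vspace 'rV[F]_3})
    (l : 'rV[F]_3) :=
  l != 0 /\ forall x, (x *m T \in L) = (x *m l^T == 0).

Section Frame.
Variables (F : fieldType) (T : 'M[F]_3).
Hypothesis T_unit : T \in unitmx.
Implicit Types (P : point F) (L M : {vspace 'rV[F]_3}) (x y l m : 'rV[F]_3).

Lemma mulmx_frame_eq0 x : (x *m T == 0) = (x == 0).
Proof.
apply/eqP/eqP => [|->]; last by rewrite mul0mx.
by move/(congr1 (mulmxr (invmx T))); rewrite /= mulmxK // mul0mx.
Qed.

Lemma mulmx_frame_inj : injective (fun x => x *m T).
Proof. by move=> x y /(congr1 (mulmxr (invmx T))); rewrite /= !mulmxK. Qed.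

Lemma dim_point P : \dim P = 1%N.
Proof. by case: P => V /= /eqP. Qed.

Lemma point_at x : x != 0 -> exists P, at_coords T P x.
Proof.
move=> x0; have dx : \dim <[x *m T]>%VS == 1%N.
  by rewrite dim_vline mulmx_frame_eq0 x0.
by exists (Point dx).
Qed.

Lemma at_coords_ex P : exists x, at_coords T P x.
Proof.
have p0 : vpick P != 0 by rewrite vpick0 -dimv_eq0 dim_point.
exists (vpick P *m invmx T); rewrite /at_coords mulmxKV //.
rewrite -mulmx_frame_eq0 mulmxKV //; split=> //.
by apply/eqP; rewrite eq_sym eqEdim -memvE memv_pick dim_point dim_vline p0.
Qed.

Lemma at_coords_scale P x k : k != 0 -> at_coords T P x -> at_coords T P (k *: x).
Proof.
move=> k0 [x0 Px]; split; first by rewrite scaler_eq0 negb_or k0.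
rewrite Px -scalemxAl; apply/eqP; rewrite eq_sym eqEdim -memvE memvZ ?memv_line //.
by rewrite !dim_vline scaler_eq0 negb_or k0 /=.
Qed.

Lemma at_coords_fun P x y :
  at_coords T P x -> at_coords T P y -> exists2 k, k != 0 & y = k *: x.
Proof.
move=> [x0 Px] [y0 Py].
have : y *m T \in <[x *m T]>%VS by rewrite -Px Py memv_line.
case/vlineP => k; rewrite scalemxAl => /mulmx_frame_inj yk.
by exists k => //; apply: contraNneq y0 => k0; rewrite yk k0 scale0r.
Qed.

Lemma point_inj P Q : point_space P = point_space Q -> P = Q.
Proof. by move=> PQ; apply: val_inj. Qed.

Lemma at_coords_inj P Q x : at_coords T P x -> at_coords T Q x -> P = Q.
Proof. by move=> [_ Px] [_ Qx]; apply: point_inj; rewrite Px Qx. Qed.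

Lemma on_line_eqn P L x l :
  has_equation T L l -> at_coords T P x -> on_line P L <-> x *m l^T = 0.
Proof.
move=> [_ Ll] [_ Px].
by rewrite /on_line Px -memvE Ll; split => /eqP.
Qed.

Lemma on_conic_coords P Q x : at_coords T P x ->
  on_conic Q P <-> x *m (T *m Q *m T^T) *m x^T = 0.
Proof.
move=> [_ Px]; rewrite -!mulmxA -trmx_mul !mulmxA.
split=> [|xQ v]; first by apply; rewrite Px memv_line.
rewrite Px => /vlineP[k ->].
by rewrite linearZ -!scalemxAl /= -scalemxAr xQ !scaler0.
Qed.

Lemma dim_line P Q : P <> Q -> \dim (line P Q) = 2%N.
Proof.
move=> PQ; have := dimv_sum_cap P Q; rewrite /line !dim_point.
case dPQ: (\dim (P :&: Q)) => [|k]; first by rewrite addn0.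
case: PQ; apply: point_inj.
have PQ1 : (0 < \dim (P :&: Q))%N by rewrite dPQ.
have PC : (P :&: Q)%VS = P.
  by apply/eqP; rewrite eqEdim capvSl dim_point.
have QC : (P :&: Q)%VS = Q.
  by apply/eqP; rewrite eqEdim capvSr dim_point.
by rewrite -PC QC.
Qed.

(** Rank-nullity: [L] is the kernel of a linear form whose values on the rows of [T] are the entries
    of [l], so the image has dimension exactly 1. *)
Lemma dim_equation L l : has_equation T L l -> \dim L = 2%N.
Proof.
move=> [l0 Ll].
pose f := linfun (mulmxr (invmx T *m l^T)) : 'Hom('rV[F]_3, 'rV[F]_1).
have fE v : f v = v *m invmx T *m l^T by rewrite lfunE /= mulmxA.
have LK : L = lker f.
  by apply/vspaceP => v; rewrite memv_ker fE -Ll mulmxKV.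
have := limg_ker_dim f fullv; rewrite capfv -LK dimvf /dim /= => dL.
have le1 : (\dim (f @: fullv) <= 1)%N.
  by apply: leq_trans (dimvS (subvf _)) _; rewrite dimvf.
suff : (0 < \dim (f @: fullv))%N.
  by case: (\dim (f @: fullv)) le1 dL => [|[]] // _; rewrite addn1 => -[].
rewrite lt0n dimv_eq0; apply: contraNneq l0 => f0.
apply/eqP/rowP => i; rewrite mxE.
have /eqP : f (delta_mx 0 i *m T) = 0.
  by apply/eqP; rewrite -memv0 -f0 memv_img ?memvf.
rewrite fE mulmxK // => /eqP/matrixP/(_ 0 0).
by rewrite -rowE !mxE.
Qed.

(** The kernel of the form [l] contains both points and has the dimension of their span. *)
Lemma line_equation P Q x y l : P <> Q -> at_coords T P x -> at_coords T Q y ->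
  l != 0 -> x *m l^T = 0 -> y *m l^T = 0 -> has_equation T (line P Q) l.
Proof.
move=> PQ [x0 Px] [y0 Qy] l0 xl yl.
pose f := linfun (mulmxr (invmx T *m l^T)) : 'Hom('rV[F]_3, 'rV[F]_1).
have fE v : f v = v *m invmx T *m l^T by rewrite lfunE /= mulmxA.
have kl : has_equation T (lker f) l.
  by split=> // v; rewrite memv_ker fE mulmxK.
suff -> : line P Q = lker f by [].
apply/eqP; rewrite eqEdim (dim_equation kl) dim_line // leqnn andbT.
by rewrite /line Px Qy subv_add -!memvE !memv_ker !fE !mulmxK // xl yl eqxx.
Qed.

Lemma is_intersection_at X L M x l m :
  has_equation T L l -> has_equation T M m -> is_intersection X L M ->
  x != 0 -> x *m l^T = 0 -> x *m m^T = 0 -> at_coords T X x.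
Proof.
move=> [_ Ll] [_ Mm] XLM x0 xl xm; split=> //; apply/eqP.
rewrite eq_sym eqEdim -memvE dim_point dim_vline mulmx_frame_eq0 x0 andbT.
by rewrite XLM memv_cap Ll Mm xl xm eqxx.
Qed.
End Frame.

(** * Tangent lines as points of the dual conic *)

Lemma proportional_of_annihilator (F : fieldType) n (l s : 'rV[F]_n) :
  l != 0 -> (forall v : 'rV[F]_n, v *m l^T = 0 -> v *m s^T = 0) ->
  exists k, s = k *: l.
Proof.
move=> l0 ls; have [i li] : exists i, l 0 i != 0.
  apply/existsP; apply: contraNT l0; rewrite negb_exists => /forallP l0.
  by apply/eqP/rowP => i; rewrite mxE; apply/eqP; rewrite -[_ == _]negbK.
have dE (t : 'rV[F]_n) j : delta_mx 0 j *m t^T = (t 0 j)%:M.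
  by rewrite [LHS]mx11_scalar -rowE !mxE.
exists (s 0 i / l 0 i); apply/rowP => j; rewrite mxE.
(* This test vector is annihilated by [l]; being annihilated by [s] as well, it gives l_i s_j = l_j
   s_i. *)
have := ls (l 0 i *: delta_mx 0 j - l 0 j *: delta_mx 0 i).
rewrite !mulmxBl -!scalemxAl !dE -!mul_scalar_mx -!scalar_mxM mulrC subrr.
move/(_ erefl)/matrixP/(_ 0 0); rewrite !mxE !mulr1n => /eqP.
rewrite subr_eq0 => /eqP h.
by rewrite mulrAC [s 0 i * _]mulrC -h mulrAC divff ?mul1r.
Qed.

Lemma mx11_form_sym (F : fieldType) n (Q : 'M[F]_n) (x y : 'rV[F]_n) :
  Q^T = Q -> x *m Q *m y^T = y *m Q *m x^T.
Proof.
move=> QT; rewrite [LHS]mx11_scalar -tr_scalar_mx -mx11_scalar.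
by rewrite !trmx_mul trmxK QT mulmxA.
Qed.

Lemma equation_fun (F : fieldType) (T : 'M[F]_3) L (l l' : 'rV[F]_3) :
  has_equation T L l -> has_equation T L l' -> exists k, l' = k *: l.
Proof.
move=> Ll Ll'; apply: proportional_of_annihilator Ll.1 _ => v vl; apply/eqP.
by rewrite -Ll'.2 Ll.2 vl.
Qed.

Section Tangent.
Variables (F : fieldType) (T Q : 'M[F]_3) (L : {vspace 'rV[F]_3}) (l : 'rV[F]_3).
Hypotheses (two : 2 != 0 :> F) (T_unit : T \in unitmx).
Hypotheses (Q_sym : Q^T = Q) (Q_unit : Q \in unitmx) (Ll : has_equation T L l).
(** The Gram matrix of the conic in the coordinates of the frame; [invmx S] is the Gram matrix of
    the dual conic. *)
Let S := T *m Q *m T^T.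
Let S_sym : S^T = S.
Proof. by rewrite /S !trmx_mul trmxK Q_sym mulmxA. Qed.
Let S_unit : S \in unitmx.
Proof. by rewrite /S !unitmx_mul unitmx_tr T_unit Q_unit. Qed.

(** The polar [p *m S] of [p] annihilates the whole line, hence is proportional to [l]; the value of
    the dual form at [l] is then a multiple of that of [S] at [p]. *)
Lemma tangent_pole (p : 'rV[F]_3) : p != 0 -> p *m S *m p^T = 0 ->
  (forall v : 'rV[F]_3, v *m l^T = 0 -> p *m S *m v^T = 0) -> l *m invmx S *m l^T = 0.
Proof.
move=> p0 pSp pS.
have [k lk] : exists k, p *m S = k *: l.
  apply: proportional_of_annihilator Ll.1 _ => v /pS pv.
  by rewrite trmx_mul mulmxA S_sym mx11_form_sym.
have k0 : k != 0.
  apply: contraNneq p0 => k0; move: lk; rewrite k0 scale0r => /eqP.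
  by rewrite mulmx_frame_eq0.
have -> : l = k^-1 *: (p *m S) by rewrite lk scalerK.
rewrite -!scalemxAl mulmxK // linearZ /= -scalemxAr trmx_mul S_sym mulmxA.
by rewrite mx11_form_sym // pSp !scaler0.
Qed.

(** Forward: the unique common point is conjugate to every point of the line, since otherwise the
    form restricted to the line would have a second zero. Backward: the pole [l *m invmx S] is a
    common point, and any other common point would have the same polar, hence coincide with it. *)
Lemma tangentP : tangent Q L <-> l *m invmx S *m l^T = 0.
Proof.
have S0 (v : 'rV[F]_3) : (v *m S == 0) = (v == 0) by apply: mulmx_frame_eq0.
split=> [[P [[PL PQ] Puniq]] | lSl].
  have [p Pp] := at_coords_ex T_unit P; have [p0 _] := Pp.
  have pl := (on_line_eqn Ll Pp).1 PL.
  have pSp := (on_conic_coords Q Pp).1 PQ.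
  apply: (tangent_pole p0 pSp) => v vl.
  pose b (x y : 'rV[F]_3) := (x *m S *m y^T) 0 0.
  have bC x y : b x y = b y x by rewrite /b mx11_form_sym.
  have bB x y z c d : b x (c *: y - d *: z) = c * b x y - d * b x z.
    rewrite /b; have -> : (c *: y - d *: z)^T = c *: y^T - d *: z^T.
      by rewrite linearB !linearZ.
    by rewrite mulmxBr -!scalemxAr !mxE.
  have bpp : b p p = 0 by rewrite /b pSp mxE.
  have [//|bpv0] := eqVneq (p *m S *m v^T) 0.
  have {}bpv0 : 2 * b p v * b p v != 0.
    rewrite !mulf_neq0 //; apply: contraNneq bpv0 => pv;
      by rewrite [X in X == _]mx11_scalar -/(b p v) pv raddf0.
  (* A second root of the quadratic form on the line. *)
  pose w := b v v *: p - (2 * b p v) *: v.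
  have bpw : b p w != 0 by rewrite bB bpp mulr0 sub0r oppr_eq0.
  have w0 : w != 0.
    by apply: contraNneq bpw => ->; rewrite /b trmx0 mulmx0 mxE.
  have wS : w *m S *m w^T = 0.
    rewrite [LHS]mx11_scalar -/(b w w) bB !(bC w) !bB bpp (bC v p).
    by rewrite [X in X%:M](_ : _ = 0) ?raddf0 //; ring.
  have [W Ww] := point_at T_unit w0.
  have PW : P = W.
    apply: Puniq; split; last by apply/(on_conic_coords _ Ww).
    apply/(on_line_eqn Ll Ww); rewrite mulmxBl -!scalemxAl vl pl.
    by rewrite !scaler0 subr0.
  (* If [w] were a multiple of [p], then [b p w] would vanish with [b p p]. *)
  rewrite -{}PW in Ww; have [k _ wk] := at_coords_fun T_unit Pp Ww.
  by move: bpw; rewrite wk -[k *: p]subr0 -(scale0r p) bB bpp !mulr0 subrr eqxx.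
pose p := l *m invmx S.
have pS : p *m S = l by rewrite mulmxKV.
have p0 : p != 0 by rewrite -S0 pS Ll.1.
have pl : p *m l^T = 0 by [].
have [P Pp] := point_at T_unit p0.
exists P; split=> [|P' [P'L P'Q]].
  split; first by apply/(on_line_eqn Ll Pp).
  apply/(on_conic_coords _ Pp); rewrite -/S pS.
  by apply: trmx_inj; rewrite trmx_mul trmxK pl trmx0.
have [v Pv] := at_coords_ex T_unit P'.
have vl := (on_line_eqn Ll Pv).1 P'L.
have vS := (on_conic_coords _ Pv).1 P'Q.
have [//|PP'] := eqVneq P P'; have {}PP' : P <> P' by apply/eqP.
have Ev : has_equation T (line P P') (v *m S).
  apply: (line_equation T_unit PP' Pp Pv); first by rewrite S0 Pv.1.
    rewrite trmx_mul S_sym mulmxA pS.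
    by apply: trmx_inj; rewrite trmx_mul trmxK vl trmx0.
  by rewrite trmx_mul S_sym mulmxA.
have El := line_equation T_unit PP' Pp Pv Ll.1 pl vl.
have [k vk] := equation_fun El Ev.
have {}vk : v = k *: p by rewrite /p scalemxAl -vk mulmxK.
have k0 : k != 0 by apply: contraNneq Pv.1 => k0; rewrite vk k0 scale0r.
by case: PP'; apply: (at_coords_inj (at_coords_scale k0 Pp)); rewrite -vk.
Qed.
End Tangent.

(** * Explicit vectors and symmetric matrices of size 3 *)

Definition vec3 (F : nzRingType) (x y z : F) : 'rV[F]_3 :=
  \row_(i < 3) [:: x; y; z]`_i.

Definition sym3 (F : nzRingType) (q00 q11 q22 q01 q02 q12 : F) : 'M[F]_3 :=
  \matrix_(i < 3) vec3 [:: q00; q01; q02]`_i [:: q01; q11; q12]`_i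
                       [:: q02; q12; q22]`_i.

Section Coordinates.
Variable F : fieldType.
Implicit Types x y z : F.

Lemma ord3P (i : 'I_3) : [\/ i = 0, i = 1 | i = 2].
Proof. by case: i => [[|[|[|//]]] h]; constructor; apply: val_inj. Qed.

Lemma vec3_eta (v : 'rV[F]_3) : v = vec3 (v 0 0) (v 0 1) (v 0 2).
Proof. by apply/rowP => i; rewrite mxE; case: (ord3P i) => ->. Qed.

Lemma vec3_eq0 x y z : (vec3 x y z == 0) = [&& x == 0, y == 0 & z == 0].
Proof.
apply/eqP/and3P => [/rowP v0|[/eqP-> /eqP-> /eqP->]].
  by split; [have := v0 0|have := v0 1|have := v0 2]; rewrite !mxE /= => ->.
by apply/rowP => i; rewrite !mxE; case: (ord3P i) => ->.
Qed.

Lemma scale_vec3 k x y z : k *: vec3 x y z = vec3 (k * x) (k * y) (k * z).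
Proof. by apply/rowP => i; rewrite !mxE; case: (ord3P i) => ->. Qed.

Lemma vec3_dot x y z x' y' z' :
  (vec3 x y z *m (vec3 x' y' z')^T == 0) = (x * x' + y * y' + z * z' == 0).
Proof.
have dE : (vec3 x y z *m (vec3 x' y' z')^T) 0 0 = x * x' + y * y' + z * z'.
  by rewrite mxE !big_ord_recl big_ord0 !mxE /= addr0 addrA.
rewrite [X in X == _]mx11_scalar dE.
by apply/eqP/eqP => [/matrixP/(_ 0 0)|->]; rewrite ?raddf0 // !mxE.
Qed.

Lemma sym3_sym (q00 q11 q22 q01 q02 q12 : F) :
  (sym3 q00 q11 q22 q01 q02 q12)^T = sym3 q00 q11 q22 q01 q02 q12.
Proof.
apply/matrixP => i j; rewrite !mxE.
by case: (ord3P i) => ->; case: (ord3P j) => ->.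
Qed.

Lemma sym3_eta (Q : 'M[F]_3) : Q^T = Q ->
  Q = sym3 (Q 0 0) (Q 1 1) (Q 2 2) (Q 0 1) (Q 0 2) (Q 1 2).
Proof.
move=> QT; apply/matrixP => i j; rewrite !mxE.
by case: (ord3P i) => ->; case: (ord3P j) => -> //=; rewrite -[in LHS]QT mxE.
Qed.

Lemma sym3_eq0 (q00 q11 q22 q01 q02 q12 : F) :
  (sym3 q00 q11 q22 q01 q02 q12 == 0) =
  [&& q00 == 0, q11 == 0, q22 == 0, q01 == 0, q02 == 0 & q12 == 0].
Proof.
apply/eqP/idP => [/matrixP q0|].
  have := (q0 0 0, q0 1 1, q0 2 2, q0 0 1, q0 0 2, q0 1 2).
  by rewrite !mxE /= => -[[[[[-> ->] ->] ->] ->] ->]; rewrite eqxx.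
case/and5P => /eqP-> /eqP-> /eqP-> /eqP-> /andP[/eqP-> /eqP->].
apply/matrixP => i j; rewrite !mxE.
by case: (ord3P i) => ->; case: (ord3P j) => ->.
Qed.

Lemma sym3_form (q00 q11 q22 q01 q02 q12 x y z : F) :
  (vec3 x y z *m sym3 q00 q11 q22 q01 q02 q12 *m (vec3 x y z)^T == 0) =
  (q00 * x ^+ 2 + q11 * y ^+ 2 + q22 * z ^+ 2
   + 2 * (q01 * x * y + q02 * x * z + q12 * y * z) == 0).
Proof.
have -> : vec3 x y z *m sym3 q00 q11 q22 q01 q02 q12 =
  vec3 (q00 * x + q01 * y + q02 * z) (q01 * x + q11 * y + q12 * z)
       (q02 * x + q12 * y + q22 * z).
  apply/rowP => i; rewrite !mxE !big_ord_recl big_ord0 !mxE /=.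
  by case: (ord3P i) => -> /=; ring.
by rewrite vec3_dot; congr (_ == 0); ring.
Qed.

Lemma det_sym3 (q00 q11 q22 q01 q02 q12 : F) :
  \det (sym3 q00 q11 q22 q01 q02 q12) =
  q00 * q11 * q22 + 2 * q01 * q02 * q12
  - q00 * q12 ^+ 2 - q11 * q02 ^+ 2 - q22 * q01 ^+ 2.
Proof.
rewrite (expand_det_row _ 0) !big_ord_recl big_ord0 /cofactor.
rewrite !(expand_det_row _ 0) !big_ord_recl !big_ord0 /cofactor !det_mx11 !mxE /=.
by ring.
Qed.
End Coordinates.

(** * Conic and tangency conditions expressed in coordinates *)

Section Transfer.
Variables (F : fieldType) (T : 'M[F]_3).
Hypothesis T_unit : T \in unitmx.

Definition vanishes_on (Q : 'M[F]_3) (xs : seq 'rV[F]_3) :=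
  all (fun x => x *m Q *m x^T == 0) xs.

(** A change of frame acts on Gram matrices by an invertible congruence. Each point is paired with
    its coordinates, so that one list serves both sides. *)
Lemma lie_on_conic_coords (ps : seq (point F * 'rV[F]_3)) :
  (forall p, p \in ps -> at_coords T p.1 p.2) ->
  lie_on_conic (unzip1 ps) <->
  exists2 Q, conic Q & vanishes_on Q (unzip2 ps).
Proof.
move=> psP; split=> -[Q [QT Q0] Qs].
  exists (T *m Q *m T^T).
    split; first by rewrite !trmx_mul trmxK QT mulmxA.
    apply: contraNneq Q0 => /(congr1 (fun M => invmx T *m M *m invmx T^T)).
    by rewrite !mulmxA mulVmx // mul1mx mulmxK ?unitmx_tr // mulmx0 mul0mx => ->.
  rewrite /vanishes_on all_map; apply/allP => p pin /=.
  by apply/eqP/(on_conic_coords _ (psP p pin))/Qs; apply: map_f.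
exists (invmx T *m Q *m (invmx T)^T).
  split; first by rewrite !trmx_mul trmxK QT mulmxA.
  apply: contraNneq Q0 => /(congr1 (fun M => T *m M *m T^T)).
  rewrite !mulmxA mulmxV // mul1mx -mulmxA -trmx_mul mulmxV //.
  by rewrite trmx1 mulmx1 mulmx0 mul0mx => ->.
move=> P /mapP[p pin ->]; apply/(on_conic_coords _ (psP p pin)).
have -> : T *m (invmx T *m Q *m (invmx T)^T) *m T^T = Q.
  by rewrite !mulmxA mulmxV // mul1mx -mulmxA -trmx_mul mulmxV // trmx1 mulmx1.
by move: Qs; rewrite /vanishes_on all_map => /allP/(_ _ pin)/eqP.
Qed.

(** By [tangentP] the matrix [S] is that of the dual conic, so tangency becomes incidence in the
    dual plane. *)
Lemma touch_conic_coords (ls : seq ({vspace 'rV[F]_3} * 'rV[F]_3)) :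
  2 != 0 :> F -> (forall l, l \in ls -> has_equation T l.1 l.2) ->
  touch_conic (unzip1 ls) <->
  (exists2 S, nondegenerate_conic S & vanishes_on S (unzip2 ls)) \/
  (exists p p' : 'rV[F]_3, [/\ p != 0, p' != 0 &
     all (fun l => (p *m l^T == 0) || (p' *m l^T == 0)) (unzip2 ls)]).
Proof.
move=> two lsP; split.
  case=> [[Q [QT Qu] Qs]|[P [P' PP']]]; [left|right].
    exists (invmx (T *m Q *m T^T)).
      split; last by rewrite unitmx_inv !unitmx_mul unitmx_tr T_unit Qu.
      by rewrite trmx_inv !trmx_mul trmxK QT mulmxA.
    rewrite /vanishes_on all_map; apply/allP => l lin /=; apply/eqP.
    by apply/(tangentP two T_unit QT Qu (lsP l lin))/Qs; apply: map_f.
  have [p Pp] := at_coords_ex T_unit P; have [p' Pp'] := at_coords_ex T_unit P'.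
  exists p, p'; split; [exact: Pp.1|exact: Pp'.1|].
  rewrite all_map; apply/allP => l lin /=; apply/orP.
  have [/(on_line_eqn (lsP l lin) Pp) -> | /(on_line_eqn (lsP l lin) Pp') ->] :=
    PP' l.1 (map_f _ lin); by [left | right].
case=> [[S [ST Su] Ss]|[p [p' [p0 p'0 pp']]]]; [left|right].
  have Qu : invmx T *m invmx S *m (invmx T)^T \in unitmx.
    by rewrite !unitmx_mul unitmx_tr !unitmx_inv T_unit Su.
  have QT : (invmx T *m invmx S *m (invmx T)^T)^T =
      invmx T *m invmx S *m (invmx T)^T.
    by rewrite !trmx_mul trmxK [(invmx S)^T]trmx_inv ST mulmxA.
  exists (invmx T *m invmx S *m (invmx T)^T) => // L /mapP[l lin ->].
  apply/(tangentP two T_unit QT Qu (lsP l lin)).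
  have -> : T *m (invmx T *m invmx S *m (invmx T)^T) *m T^T = invmx S.
    by rewrite !mulmxA mulmxV // mul1mx -mulmxA -trmx_mul mulmxV // trmx1 mulmx1.
  by rewrite invmxK; move: Ss; rewrite /vanishes_on all_map => /allP/(_ _ lin)/eqP.
have [P Pp] := point_at T_unit p0; have [P' Pp'] := point_at T_unit p'0.
exists P, P' => L /mapP[l lin ->].
move: pp'; rewrite all_map => /allP/(_ _ lin)/orP[]/eqP pl; [left|right].
  exact/(on_line_eqn (lsP l lin) Pp).
exact/(on_line_eqn (lsP l lin) Pp').
Qed.
End Transfer.

(** * Carnot's theorem and its dual *)

Section Algebra.
Variable F : fieldType.
Hypothesis two : 2 != 0 :> F.
Implicit Types a b c : F.

Lemma conic_sym3 (Q : 'M[F]_3) : conic Q -> exists q00 q11 q22 q01 q02 q12,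
  Q = sym3 q00 q11 q22 q01 q02 q12 /\
  ~~ [&& q00 == 0, q11 == 0, q22 == 0, q01 == 0, q02 == 0 & q12 == 0].
Proof.
move=> [/sym3_eta-> Q0]; do 6!eexists; split; first by [].
by rewrite -sym3_eq0.
Qed.

(** The ratios a1 / a1' and a2 / a2' are the two distinct roots of a binary quadratic form, with
    product r / p; homogeneity also covers roots at infinity. *)
Lemma vieta_homogeneous (p m r a1 a1' a2 a2' : F) :
  p * a1 ^+ 2 + 2 * m * a1 * a1' + r * a1' ^+ 2 = 0 ->
  p * a2 ^+ 2 + 2 * m * a2 * a2' + r * a2' ^+ 2 = 0 ->
  a1 * a2' != a2 * a1' -> p * (a1 * a2) = r * (a1' * a2').
Proof.
move=> h1 h2; rewrite -subr_eq0 => d; apply/eqP; rewrite -subr_eq0.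
suff /eqP : (a1 * a2' - a2 * a1') * (p * (a1 * a2) - r * (a1' * a2')) = 0.
  by rewrite mulf_eq0 (negPf d).
(* This combination of the two equations eliminates [m]. *)
transitivity (a2 * a2' * 0 - a1 * a1' * (0 : F)); last by rewrite !mulr0 subr0.
by rewrite -{1}h1 -h2; ring.
Qed.

(* With all primed entries equal to 1 this is Carnot's theorem for six points
   on the sides of the triangle; the dual configuration is another instance. *)
Lemma carnot_necessary a1 a1' a2 a2' b1 b1' b2 b2' c1 c1' c2 c2' Q :
  [&& a1 != 0, a1' != 0, a2 != 0 & a2' != 0] ->
  [&& b1 != 0, b1' != 0, b2 != 0 & b2' != 0] ->
  [&& c1 != 0, c1' != 0, c2 != 0 & c2' != 0] ->
  a1 * a2' != a2 * a1' -> b1 * b2' != b2 * b1' -> c1 * c2' != c2 * c1' ->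
  conic Q ->
  vanishes_on Q [:: vec3 0 a1 a1'; vec3 0 a2 a2'; vec3 b1' 0 b1; vec3 b2' 0 b2;
                    vec3 c1 c1' 0; vec3 c2 c2' 0] ->
  a1 * a2 * b1 * b2 * c1 * c2 = a1' * a2' * b1' * b2' * c1' * c2'.
Proof.
move=> /and4P[a10 a10' a20 a20'] /and4P[b10 b10' b20 b20'].
move=> /and4P[c10 c10' c20 c20'] ha hb hc.
move=> /conic_sym3[q00 [q11 [q22 [q01 [q02 [q12 [-> q_neq0]]]]]]].
rewrite /vanishes_on /= !sym3_form.
move=> /and5P[/eqP A1 /eqP A2 /eqP B1 /eqP B2 /and3P[/eqP C1 /eqP C2 _]].
have ea : q11 * (a1 * a2) = q22 * (a1' * a2').
  by apply: (@vieta_homogeneous _ q12) ha; [rewrite -A1|rewrite -A2]; ring.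
have eb : q22 * (b1 * b2) = q00 * (b1' * b2').
  by apply: (@vieta_homogeneous _ q02) hb; [rewrite -B1|rewrite -B2]; ring.
have ec : q00 * (c1 * c2) = q11 * (c1' * c2').
  by apply: (@vieta_homogeneous _ q01) hc; [rewrite -C1|rewrite -C2]; ring.
(* The three relations make the diagonal entries vanish together. If they do, a point on each side,
   away from the vertices, kills the remaining mixed coefficient, and the conic would be zero. *)
have [q110|q110] := eqVneq q11 0.
  case/negP: q_neq0.
  have q22_0 : q22 = 0.
    move/eqP: ea; rewrite q110 mul0r eq_sym !mulf_eq0.
    by rewrite (negPf a10') (negPf a20') !orbF => /eqP.
  have q00_0 : q00 = 0.
    move/eqP: ec; rewrite q110 mul0r !mulf_eq0.
    by rewrite (negPf c10) (negPf c20) !orbF => /eqP.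
  have z (q x y : F) : 2 * q * x * y = 0 -> x != 0 -> y != 0 -> q == 0.
    by move/eqP; rewrite !mulf_eq0 (negPf two) /= => /orP[/orP[//|->]|->].
  rewrite q110 q22_0 q00_0 eqxx /=; apply/and3P; split.
  - by apply: (z _ c1 c1'); rewrite // -C1 q00_0 q110; ring.
  - by apply: (z _ b1' b1); rewrite // -B1 q00_0 q22_0; ring.
  - by apply: (z _ a1 a1'); rewrite // -A1 q22_0 q110; ring.
have q22_0 : q22 != 0.
  apply: contraTneq q110 => q0; move/eqP: ea.
  by rewrite q0 mul0r !mulf_eq0 (negPf a10) (negPf a20) !orbF => ->.
have q00_0 : q00 != 0.
  apply: contraTneq q110 => q0; move/esym/eqP: ec.
  by rewrite q0 mul0r !mulf_eq0 (negPf c10') (negPf c20') !orbF => ->.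
apply: (mulfI q110); apply: (mulfI q22_0); apply: (mulfI q00_0).
transitivity (q11 * (a1 * a2) * (q22 * (b1 * b2)) * (q00 * (c1 * c2))); first by ring.
by rewrite ea eb ec; ring.
Qed.

(** The conic is prescribed on each side: it restricts to 2 (y - a1 z)(y - a2 z) on x = 0, to 2 a1
    a2 (z - b1 x)(z - b2 x) on y = 0, and to 2 a1 a2 b1 b2 (x - c1 y)(x - c2 y) on z = 0. The first
    and third agree at the vertex B exactly because the product is 1. *)
Lemma carnot_sufficient a1 a2 b1 b2 c1 c2 :
  a1 * a2 * b1 * b2 * c1 * c2 = 1 ->
  exists2 Q : 'M[F]_3, conic Q &
  vanishes_on Q [:: vec3 0 a1 1; vec3 0 a2 1; vec3 1 0 b1; vec3 1 0 b2;
                    vec3 c1 1 0; vec3 c2 1 0].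
Proof.
move=> K.
exists (sym3 (2 * (a1 * a2 * b1 * b2)) 2 (2 * (a1 * a2)) (- (a1 * a2 * b1 * b2 * (c1 + c2)))
         (- (a1 * a2 * (b1 + b2))) (- (a1 + a2))).
  by split; [exact: sym3_sym|rewrite sym3_eq0 (negPf two) /= andbF].
rewrite /vanishes_on /= !sym3_form !andbT.
apply/and5P; split; last (apply/andP; split); apply/eqP; try by ring.
  by transitivity (2 * (1 - a1 * a2 * b1 * b2 * c1 * c2)); [ring|rewrite K; ring].
by transitivity (2 * (1 - a1 * a2 * b1 * b2 * c1 * c2)); [ring|rewrite K; ring].
Qed.

(** The witnesses are the common points of the two concurrent triples of cevians. *)
Lemma two_pencils a1 a2 b1 b2 c1 c2 : b1 != 0 -> b2 != 0 ->
  a1 * b1 * c1 = 1 -> a2 * b2 * c2 = 1 ->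
  exists p p' : 'rV[F]_3, [/\ p != 0, p' != 0 &
  all (fun l => (p *m l^T == 0) || (p' *m l^T == 0))
    [:: vec3 0 1 (- a1); vec3 0 1 (- a2); vec3 (- b1) 0 1; vec3 (- b2) 0 1;
        vec3 1 (- c1) 0; vec3 1 (- c2) 0]].
Proof.
move=> b10 b20 h1 h2; exists (vec3 1 (a1 * b1) b1), (vec3 1 (a2 * b2) b2).
rewrite !vec3_eq0 !oner_eq0 /=; split => //; rewrite !vec3_dot.
have e1 : 1 * 1 + a1 * b1 * - c1 + b1 * 0 = 1 - a1 * b1 * c1 by ring.
have e2 : 1 * 1 + a2 * b2 * - c2 + b2 * 0 = 1 - a2 * b2 * c2 by ring.
rewrite e1 e2 h1 h2 subrr eqxx orbT !andbT.
by apply/and4P; split; apply/orP; (try by left; apply/eqP; ring); right; apply/eqP; ring.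
Qed.

Lemma dual_carnot_sufficient a1 a2 b1 b2 c1 c2 :
  a1 * a2 * b1 * b2 * c1 * c2 = 1 ->
  let ls := [:: vec3 0 1 (- a1); vec3 0 1 (- a2); vec3 (- b1) 0 1;
    vec3 (- b2) 0 1; vec3 1 (- c1) 0; vec3 1 (- c2) 0] in
  (exists2 S, nondegenerate_conic S & vanishes_on S ls) \/
  (exists p p' : 'rV[F]_3, [/\ p != 0, p' != 0 &
     all (fun l => (p *m l^T == 0) || (p' *m l^T == 0)) ls]).
Proof.
move=> K ls.
have /and5P[a10 a20 b10 b20 /andP[c10 c20]] :
  [&& a1 != 0, a2 != 0, b1 != 0, b2 != 0, c1 != 0 & c2 != 0].
  move: (oner_neq0 F); rewrite -K !mulf_eq0 !negb_or -!andbA.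
  by case/and5P => -> -> -> -> ->.
(* Prescribed on the sides of the dual triangle, as in [carnot_sufficient]: 2 b1 b2 (z + a1 y)(z +
   a2 y) on x = 0, 2 (x + b1 z)(x + b2 z) on y = 0, and similarly on z = 0. *)
pose S := sym3 2 (2 * (a1 * a2 * b1 * b2)) (2 * (b1 * b2))
  (a1 * a2 * b1 * b2 * (c1 + c2)) (b1 + b2) (b1 * b2 * (a1 + a2)).
have [Su|S_singular] := boolP (S \in unitmx); [left|right].
  exists S; first by split=> //; exact: sym3_sym.
  rewrite /vanishes_on /= !sym3_form !andbT.
  apply/and5P; split; last (apply/andP; split); apply/eqP; try by ring.
    by transitivity (2 * (1 - a1 * a2 * b1 * b2 * c1 * c2)); [ring|rewrite K; ring].
  by transitivity (2 * (1 - a1 * a2 * b1 * b2 * c1 * c2)); [ring|rewrite K; ring].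
have ec2 : c2 = (a1 * a2 * b1 * b2 * c1)^-1.
  by apply: (mulfI (x := a1 * a2 * b1 * b2 * c1)); rewrite ?K ?divff // !mulf_neq0.
move: S_singular; rewrite unitmxE unitfE.
(* The four factors correspond to the four ways of splitting the six cevians into two triples with
   one cevian from each vertex. A zero factor makes one triple concurrent, and [K] makes the
   complementary one concurrent too. *)
have -> : \det S = 2 * a2 * b1 * b2 ^+ 2 / c1 * ((a1 * b1 * c1 - 1) *
   (a1 * b1 * c2 - 1) * (a1 * b2 * c1 - 1) * (a2 * b1 * c1 - 1)).
  rewrite det_sym3 ec2; field; rewrite ?a10 ?a20 ?b10 ?b20 ?c10 //.
rewrite negbK mulf_eq0 !mulf_eq0 invr_eq0 (negPf two) (negPf a20) (negPf b10).
rewrite (negPf b20) (negPf c10) /= !subr_eq0.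
have pair (x y : F) : x * y = 1 -> x == 1 -> x = 1 /\ y = 1.
  by move=> xy /eqP x1; rewrite x1 mul1r in xy.
case/orP => [/orP[/orP[]|]|] /pair h.
- have [|h1 h2] := h (a2 * b2 * c2); first by rewrite -K; ring.
  exact: two_pencils.
- have [|h1 h2] := h (a2 * b2 * c1); first by rewrite -K; ring.
  have [p [p' [p0 p'0 pp']]] := two_pencils b10 b20 h1 h2.
  by exists p, p'; split=> //; move: pp' => /= /and5P[-> -> -> -> /and3P[-> ->]].
- have [|h1 h2] := h (a2 * b1 * c2); first by rewrite -K; ring.
  have [p [p' [p0 p'0 pp']]] := two_pencils b20 b10 h1 h2.
  by exists p, p'; split=> //; move: pp' => /= /and5P[-> -> -> -> /and3P[-> ->]].
have [|h1 h2] := h (a1 * b2 * c2); first by rewrite -K; ring.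
have [p [p' [p0 p'0 pp']]] := two_pencils b10 b20 h1 h2.
by exists p, p'; split=> //; move: pp' => /= /and5P[-> -> -> -> /and3P[-> ->]].
Qed.

(** A pair of points is a degenerate dual conic: the symmetrised product of [p] and [p'] takes the
    value 2 (p . l)(p' . l) at [l]. *)
Lemma point_pair_conic (p p' : 'rV[F]_3) (ls : seq 'rV[F]_3) :
  p != 0 -> p' != 0 ->
  all (fun l => (p *m l^T == 0) || (p' *m l^T == 0)) ls ->
  exists2 S, conic S & vanishes_on S ls.
Proof.
move=> p0 p'0 pls; exists (p^T *m p' + p'^T *m p); last first.
  apply: sub_all pls => l /orP[]/eqP pl.
    have lp : l *m p^T = 0 by apply: trmx_inj; rewrite trmx_mul trmxK pl trmx0.
    by rewrite mulmxDr !mulmxA mulmxDl lp !mul0mx -mulmxA pl mulmx0 addr0.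
  have lp : l *m p'^T = 0 by apply: trmx_inj; rewrite trmx_mul trmxK pl trmx0.
  by rewrite mulmxDr !mulmxA mulmxDl lp !mul0mx -mulmxA pl mulmx0 addr0.
split; first by rewrite linearD /= !trmx_mul !trmxK addrC.
have [i pi] : exists i, p 0 i != 0.
  apply/existsP; apply: contraNT p0; rewrite negb_exists => /forallP p0.
  by apply/eqP/rowP => i; rewrite mxE; apply/eqP; rewrite -[_ == _]negbK.
(* Where [p] has a nonzero entry i, the diagonal entry (i, i) forces p'_i = 0, and then row i forces
   [p'] to vanish. *)
apply: contraNneq p'0 => /matrixP S0.
have E j : p 0 i * p' 0 j + p' 0 i * p 0 j = 0.
  by have := S0 i j; rewrite !mxE !big_ord1 !mxE.
have p'i : p' 0 i = 0.
  have /eqP : 2 * p 0 i * p' 0 i = 0 by rewrite -(E i); ring.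
  by rewrite !mulf_eq0 (negPf two) (negPf pi) => /eqP.
apply/eqP/rowP => j; rewrite mxE; have /eqP := E j.
by rewrite p'i mul0r addr0 mulf_eq0 (negPf pi) => /eqP.
Qed.
End Algebra.

(** * The conic through the vertices of the two inner triangles *)

Definition rows3 (F : nzRingType) (u v w : 'rV[F]_3) : 'M[F]_3 :=
  \matrix_(i < 3) [:: u; v; w]`_i.

Lemma det_rows3 (F : fieldType) (x y z x' y' z' x'' y'' z'' : F) :
  \det (rows3 (vec3 x y z) (vec3 x' y' z') (vec3 x'' y'' z'')) =
  x * (y' * z'' - z' * y'') - y * (x' * z'' - z' * x'')
  + z * (x' * y'' - y' * x'').
Proof.
rewrite (expand_det_row _ 0) !big_ord_recl big_ord0 /cofactor.
rewrite !(expand_det_row _ 0) !big_ord_recl !big_ord0 /cofactor !det_mx11 !mxE /=.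
by ring.
Qed.

Lemma vec3_mul_rows3 (F : fieldType) (x y z : F) (u v w : 'rV[F]_3) :
  vec3 x y z *m rows3 u v w = x *: u + y *: v + z *: w.
Proof.
apply/rowP => i; rewrite !mxE !big_ord_recl big_ord0 !mxE /=.
by rewrite addr0 addrA.
Qed.

Lemma rows3_kernel (F : fieldType) (u v w g : 'rV[F]_3) :
  (g *m (rows3 u v w)^T == 0) =
  [&& u *m g^T == 0, v *m g^T == 0 & w *m g^T == 0].
Proof.
have rE i : row i (rows3 u v w) = [:: u; v; w]`_i by rewrite rowK.
rewrite -trmx_eq0 trmx_mul trmxK.
apply/eqP/and3P => [h|[/eqP hu /eqP hv /eqP hw]].
  have r (i : 'I_3) : [:: u; v; w]`_i *m g^T = 0 by rewrite -rE -row_mul h row0.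
  by split; apply/eqP; [apply: (r 0)|apply: (r 1)|apply: (r 2)].
apply/row_matrixP => i; rewrite row_mul rE row0.
by case: (ord3P i) => ->.
Qed.

Section Inscribed.
Variables (F : fieldType) (a1 a2 b1 b2 c1 c2 : F).
Hypothesis two : 2 != 0 :> F.

Let K := a1 * a2 * b1 * b2 * c1 * c2.

(* With l = y - a1 z, m = z - b1 x, n = x - c1 y the sides of the triangle
   X1 Y1 Z1, the conics circumscribed to it are
   alpha m n + beta n l + gamma l m = 0; the rows are the values of
   (m n, n l, l m) at X2, Y2 and Z2. *)
Let M := rows3
  (vec3 ((b2 - b1) * c2 * (c2 - c1)) ((c2 - c1) * (1 - a1 * b2 * c2))
        ((1 - a1 * b2 * c2) * ((b2 - b1) * c2)))
  (vec3 ((1 - b1 * c2 * a2) * ((c2 - c1) * a2)) ((c2 - c1) * a2 * (a2 - a1))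
        ((a2 - a1) * (1 - b1 * c2 * a2)))
  (vec3 ((b2 - b1) * (1 - c1 * a2 * b2)) ((1 - c1 * a2 * b2) * ((a2 - a1) * b2))
        ((a2 - a1) * b2 * (b2 - b1))).

(** The differences vanish when two cevians from one vertex coincide, and the squared factor when
    the second triple is concurrent; excluding these leaves K - 1. *)
Let det_M : \det M =
  (a1 - a2) * (b1 - b2) * (c1 - c2) * (a2 * b2 * c2 - 1) ^+ 2 * (K - 1).
Proof. by rewrite det_rows3 /K; ring. Qed.

(** Coordinates of X1, X2, Y1, Y2, Z1, Z2 in this order. *)
Let six := [:: vec3 c1 1 (b1 * c1); vec3 c2 1 (b2 * c2);
  vec3 (c1 * a1) a1 1; vec3 (c2 * a2) a2 1;
  vec3 1 (a1 * b1) b1; vec3 1 (a2 * b2) b2].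

Lemma six_points_sufficient : K = 1 ->
  exists2 Q, conic Q & vanishes_on Q six.
Proof.
move=> K1.
have /and5P[a10 _ b10 _ /andP[c10 _]] :
  [&& a1 != 0, a2 != 0, b1 != 0, b2 != 0, c1 != 0 & c2 != 0].
  move: (oner_neq0 F); rewrite -K1 /K !mulf_eq0 !negb_or -!andbA.
  by case/and5P => -> -> -> -> ->.
have /eqP/det0P[g g0] : \det M^T = 0 by rewrite det_tr det_M K1 subrr mulr0.
rewrite (vec3_eta g) in g0 *; move: (g 0 0) (g 0 1) (g 0 2) g0 => al be ga g0.
move/eqP; rewrite rows3_kernel !vec3_dot => /and3P[/eqP hX /eqP hY /eqP hZ].
(* The Gram matrix of 2 (alpha m n + beta n l + gamma l m), doubled to avoid halves in the mixed
   entries; the kernel relations put X2, Y2, Z2 on it. *)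
exists (sym3 (- 2 * (b1 * al)) (- 2 * (c1 * be)) (- 2 * (a1 * ga))
  (b1 * c1 * al + be - b1 * ga) (al - a1 * be + a1 * b1 * ga)
  (- c1 * al + a1 * c1 * be + ga)).
  split; first exact: sym3_sym.
  rewrite sym3_eq0; apply: contra g0.
  rewrite !mulf_eq0 !oppr_eq0 (negPf two) (negPf a10) (negPf b10) (negPf c10) /=.
  by rewrite vec3_eq0 => /and4P[-> -> -> _].
rewrite /vanishes_on /= !sym3_form !andbT.
apply/and5P; split; last (apply/andP; split); apply/eqP; try by ring.
- by rewrite -[RHS](mulr0 2) -hX; ring.
- by rewrite -[RHS](mulr0 2) -hY; ring.
by rewrite -[RHS](mulr0 2) -hZ; ring.
Qed.

Lemma six_points_necessary Q : a1 != a2 -> b1 != b2 -> c1 != c2 ->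
  a1 * b1 * c1 != 1 -> a2 * b2 * c2 != 1 ->
  conic Q -> vanishes_on Q six -> K = 1.
Proof.
move=> ha hb hc p1 p2 /conic_sym3[q00 [q11 [q22 [q01 [q02 [q12 [-> q_neq0]]]]]]].
rewrite /vanishes_on /= !sym3_form.
move=> /and5P[/eqP X1 /eqP X2 /eqP Y1 /eqP Y2 /and3P[/eqP Z1 /eqP Z2 _]].
apply/eqP; apply: contraR q_neq0 => K1.
have Mu : M \in unitmx.
  by rewrite unitmxE unitfE det_M !mulf_neq0 ?expf_neq0 // subr_eq0.
pose q x y z := q00 * x ^+ 2 + q11 * y ^+ 2 + q22 * z ^+ 2
  + 2 * (q01 * x * y + q02 * x * z + q12 * y * z).
(* The polar form of [q]; [al], [be], [ga] are its values at the pairs (Y1, Z1), (Z1, X1), (X1,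
   Y1). *)
pose q' x y z x' y' z' := q00 * x * x' + q11 * y * y' + q22 * z * z'
  + (q01 * (x * y' + y * x') + q02 * (x * z' + z * x') + q12 * (y * z' + z * y')).
pose al := q' (c1 * a1) a1 1 1 (a1 * b1) b1.
pose be := q' 1 (a1 * b1) b1 c1 1 (b1 * c1).
pose ga := q' c1 1 (b1 * c1) (c1 * a1) a1 1.
(* Since (1 - a1 b1 c1) (x, y, z) = l X1 + m Y1 + n Z1, this expands [q] in the basis X1, Y1, Z1;
   the square terms drop out because the conic passes through these points. *)
have qE x y z : (1 - a1 * b1 * c1) ^+ 2 * q x y z =
  2 * ((z - b1 * x) * (x - c1 * y) * al + (x - c1 * y) * (y - a1 * z) * be
       + (y - a1 * z) * (z - b1 * x) * ga).
  transitivity ((y - a1 * z) ^+ 2 * q c1 1 (b1 * c1)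
    + (z - b1 * x) ^+ 2 * q (c1 * a1) a1 1
    + (x - c1 * y) ^+ 2 * q 1 (a1 * b1) b1
    + 2 * ((z - b1 * x) * (x - c1 * y) * al + (x - c1 * y) * (y - a1 * z) * be
       + (y - a1 * z) * (z - b1 * x) * ga)).
    by rewrite /al /be /ga /q' /q; ring.
  by rewrite [q c1 _ _]X1 [q (c1 * a1) _ _]Y1 [q 1 _ _]Z1 !mulr0 !add0r.
have half (x y z s t u : F) : q x y z = 0 -> s = (z - b1 * x) * (x - c1 * y) ->
    t = (x - c1 * y) * (y - a1 * z) -> u = (y - a1 * z) * (z - b1 * x) ->
    s * al + t * be + u * ga == 0.
  move=> q0 -> -> ->; have /esym/eqP := qE x y z.
  by rewrite q0 mulr0 mulf_eq0 (negPf two).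
(* Evaluation at X2, Y2, Z2 places the coefficients in the kernel of the invertible [M], so [q]
   vanishes identically. *)
have : vec3 al be ga *m M^T == 0.
  rewrite rows3_kernel !vec3_dot; apply/and3P; split.
  - by apply: (half _ _ _ _ _ _ X2); ring.
  - by apply: (half _ _ _ _ _ _ Y2); ring.
  by apply: (half _ _ _ _ _ _ Z2); ring.
rewrite mulmx_frame_eq0 ?unitmx_tr // vec3_eq0 => /and3P[/eqP al0 /eqP be0 /eqP ga0].
have q0 x y z : q x y z = 0.
  have /eqP := qE x y z; rewrite al0 be0 ga0 !mulr0 !addr0 mulr0 mulf_eq0.
  by rewrite expf_eq0 subr_eq0 eq_sym (negPf p1) => /eqP.
have q00_0 : q00 = 0 by rewrite -(q0 1 0 0) /q; ring.
have q11_0 : q11 = 0 by rewrite -(q0 0 1 0) /q; ring.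
have q22_0 : q22 = 0 by rewrite -(q0 0 0 1) /q; ring.
have mixed (s : F) : 2 * s = 0 -> s == 0.
  by move/eqP; rewrite mulf_eq0 (negPf two).
rewrite q00_0 q11_0 q22_0 eqxx /=; apply/and3P; split; apply: mixed.
- by rewrite -(q0 1 1 0) /q q00_0 q11_0; ring.
- by rewrite -(q0 1 0 1) /q q00_0 q22_0; ring.
by rewrite -(q0 0 1 1) /q q11_0 q22_0; ring.
Qed.
End Inscribed.

(** * Concurrency of three cevians as Ceva's condition *)

Section Concurrency.
Variables (F : fieldType) (T : 'M[F]_3) (L M N : {vspace 'rV[F]_3}) (u v w : F).
Hypotheses (T_unit : T \in unitmx) (Lu : has_equation T L (vec3 0 1 (- u)))
  (Mv : has_equation T M (vec3 (- v) 0 1)) (Nw : has_equation T N (vec3 1 (- w) 0)).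

(** The equations y = u z, z = v x, x = w y chain into x = u v w x, where x = 0 would force y = z =
    0. They determine the point completely, so uniqueness in [meet_in_single_pointE] is
    automatic. *)
Lemma common_point P :
  [/\ on_line P L, on_line P M & on_line P N] <->
  u * v * w = 1 /\ at_coords T P (vec3 1 (u * v) v).
Proof.
split=> [[PL PM PN]|[uvw Pp]]; last first.
  split; [apply/(on_line_eqn Lu Pp)|apply/(on_line_eqn Mv Pp)|apply/(on_line_eqn Nw Pp)];
    apply/eqP; rewrite vec3_dot; apply/eqP; try by ring.
  by transitivity (1 - u * v * w); [ring|rewrite uvw subrr].
have [p Pp] := at_coords_ex T_unit P; rewrite (vec3_eta p) in Pp.
move: (p 0 0) (p 0 1) (p 0 2) Pp => x y z Pp.
have /eqP := (on_line_eqn Nw Pp).1 PN; rewrite vec3_dot => /eqP N0.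
have /eqP := (on_line_eqn Mv Pp).1 PM; rewrite vec3_dot => /eqP M0.
have /eqP := (on_line_eqn Lu Pp).1 PL; rewrite vec3_dot => /eqP L0.
have yE : y = u * z by apply/eqP; rewrite -subr_eq0 -L0; apply/eqP; ring.
have zE : z = v * x by apply/eqP; rewrite -subr_eq0 -M0; apply/eqP; ring.
have xE : x = w * y by apply/eqP; rewrite -subr_eq0 -N0; apply/eqP; ring.
have x0 : x != 0.
  by apply: contraNneq Pp.1 => x0; rewrite yE zE x0 !mulr0 vec3_eq0 eqxx.
split; first by apply: (mulfI x0); rewrite mulr1 {2}xE yE zE; ring.
have -> : vec3 1 (u * v) v = x^-1 *: vec3 x y z.
  by rewrite scale_vec3 yE zE; congr vec3; field.
by apply: at_coords_scale; rewrite ?invr_eq0.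
Qed.

Lemma concurrentE : concurrent L M N <-> u * v * w = 1.
Proof.
split=> [[P /common_point[]//]|uvw].
have p0 : vec3 1 (u * v) v != 0 by rewrite vec3_eq0 oner_eq0.
by have [P Pp] := point_at T_unit p0; exists P; apply/common_point.
Qed.

Lemma meet_in_single_pointE : meet_in_single_point L M N <-> u * v * w = 1.
Proof.
rewrite -concurrentE; split=> [[P [h _]]|[P hP]]; first by exists P.
exists P; split=> // P' /common_point[_ P'p].
by have [_ Pp] := (common_point P).1 hP; apply: at_coords_inj P'p.
Qed.
End Concurrency.

(** * Coordinates of the feet, cevians and intersection points *)

Lemma triangle_frame (F : fieldType) (A B C : point F) : triangle A B C ->
  exists T : 'M[F]_3, [/\ T \in unitmx, at_coords T A (vec3 1 0 0),
    at_coords T B (vec3 0 1 0) & at_coords T C (vec3 0 0 1)].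
Proof.
move=> hABC.
have gen (P : point F) : exists p : 'rV[F]_3, point_space P = <[p]>%VS.
  by have [p [_ Pp]] := at_coords_ex (unitmx1 F 3) P; exists p; rewrite Pp mulmx1.
have [[u Au] [[v Bv] [w Cw]]] := (gen A, (gen B, gen C)).
exists (rows3 u v w); split; last 3 first.
1-3: split; first by rewrite vec3_eq0 oner_eq0 ?andbF.
1-3: by rewrite vec3_mul_rows3 !scale0r scale1r ?addr0 ?add0r.
(* As A, B, C span the space, every unit vector is a combination of the rows, which makes the frame
   invertible. *)
rewrite -row_full_unit -sub1mx; apply/row_subP => i.
have : row i 1%:M \in (A + B + C)%VS by rewrite hABC memvf.
rewrite Au Bv Cw => /memv_addP[_ /memv_addP[_ /vlineP[a ->] [_ /vlineP[b ->] ->]]].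
by case=> _ /vlineP[c ->] ->; rewrite -vec3_mul_rows3 submxMl.
Qed.

(** In P = s x + t y, s = 0 would give P = R and t = 0 would give P = Q; dividing by t normalises
    the second coefficient. *)
Lemma cevian_foot_at (F : fieldType) (T : 'M[F]_3) (Q R P : point F) (x y : 'rV[F]_3) :
  T \in unitmx -> at_coords T Q x -> at_coords T R y -> cevian_foot Q R P ->
  exists2 a, a != 0 & at_coords T P (a *: x + y).
Proof.
move=> T_unit Qx Ry [PQR PQ PR].
have [w Pw] := at_coords_ex T_unit P.
have : w *m T \in line Q R.
  by apply: (subvP PQR); rewrite Pw.2 memv_line.
rewrite /line Qx.2 Ry.2 => /memv_addP[_ /vlineP[s ->] [_ /vlineP[t ->]]].
rewrite !scalemxAl -mulmxDl => /(mulmx_frame_inj T_unit) wE.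
have s0 : s != 0.
  apply: contra_not_neq PR => s0; have t0 : t != 0.
    by apply: contraNneq Pw.1 => t0; rewrite wE s0 t0 !scale0r addr0.
  by apply: (at_coords_inj Pw); rewrite wE s0 scale0r add0r; apply: at_coords_scale.
have t0 : t != 0.
  apply: contra_not_neq PQ => t0.
  by apply: (at_coords_inj Pw); rewrite wE t0 scale0r addr0; apply: at_coords_scale.
exists (t^-1 * s); first by rewrite mulf_neq0 ?invr_eq0.
have -> : (t^-1 * s) *: x + y = t^-1 *: w by rewrite wE scalerDr !scalerA mulVf ?scale1r.
by apply: at_coords_scale; rewrite ?invr_eq0.
Qed.

Section Cevians.
Variables (F : fieldType) (T : 'M[F]_3) (A B C : point F).
Hypotheses (T_unit : T \in unitmx) (Ae : at_coords T A (vec3 1 0 0))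
  (Be : at_coords T B (vec3 0 1 0)) (Ce : at_coords T C (vec3 0 0 1)).
Implicit Types (P : point F) (x y z : F).

Lemma vec3_neq_at P Q x y z x' y' z' :
  at_coords T P (vec3 x y z) -> at_coords T Q (vec3 x' y' z') ->
  [|| (x == 0) && (x' != 0), (y == 0) && (y' != 0) | (z == 0) && (z' != 0)] ->
  P <> Q.
Proof.
move=> Px Qx h PQ; rewrite -PQ in Qx; have [k _] := at_coords_fun T_unit Px Qx.
rewrite scale_vec3 => /rowP e; have := e 2; have := e 1; have := e 0.
rewrite !mxE /= => xE yE zE.
by case/or3P: h => /andP[/eqP u]; rewrite (xE, yE, zE) ?xE ?yE ?zE u mulr0 eqxx.
Qed.

(** Formulated for any point with y / z = u, so as to serve both the feet on BC and the point U1. *)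
Lemma cevian_equationA P x y z u : z != 0 -> y = u * z ->
  at_coords T P (vec3 x y z) -> has_equation T (line A P) (vec3 0 1 (- u)).
Proof.
move=> z0 yE Pp; apply: (line_equation T_unit _ Ae Pp).
- by apply: (vec3_neq_at Ae Pp); rewrite eqxx z0 !orbT.
- by rewrite vec3_eq0 oner_eq0 andbF.
- by apply/eqP; rewrite vec3_dot; apply/eqP; ring.
by apply/eqP; rewrite vec3_dot yE; apply/eqP; ring.
Qed.

Lemma cevian_equationB P x y z v : x != 0 -> z = v * x ->
  at_coords T P (vec3 x y z) -> has_equation T (line B P) (vec3 (- v) 0 1).
Proof.
move=> x0 zE Pp; apply: (line_equation T_unit _ Be Pp).
- by apply: (vec3_neq_at Be Pp); rewrite eqxx x0.
- by rewrite vec3_eq0 oner_eq0 !andbF.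
- by apply/eqP; rewrite vec3_dot; apply/eqP; ring.
by apply/eqP; rewrite vec3_dot zE; apply/eqP; ring.
Qed.

Lemma cevian_equationC P x y z w : y != 0 -> x = w * y ->
  at_coords T P (vec3 x y z) -> has_equation T (line C P) (vec3 1 (- w) 0).
Proof.
move=> y0 xE Pp; apply: (line_equation T_unit _ Ce Pp).
- by apply: (vec3_neq_at Ce Pp); rewrite eqxx y0 orbT.
- by rewrite vec3_eq0 oner_eq0.
- by apply/eqP; rewrite vec3_dot; apply/eqP; ring.
by apply/eqP; rewrite vec3_dot xE; apply/eqP; ring.
Qed.

Lemma footA P : cevian_foot B C P ->
  exists2 a, a != 0 & at_coords T P (vec3 0 a 1).
Proof.
case/(cevian_foot_at T_unit Be Ce) => a a0; rewrite scale_vec3 => Pa.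
exists a => //; congr (at_coords T P _): Pa.
by apply/rowP => i; rewrite !mxE; case: (ord3P i) => -> /=; ring.
Qed.

Lemma footB P : cevian_foot C A P ->
  exists2 b, b != 0 & at_coords T P (vec3 1 0 b).
Proof.
case/(cevian_foot_at T_unit Ce Ae) => b b0; rewrite scale_vec3 => Pb.
exists b => //; congr (at_coords T P _): Pb.
by apply/rowP => i; rewrite !mxE; case: (ord3P i) => -> /=; ring.
Qed.

Lemma footC P : cevian_foot A B P ->
  exists2 c, c != 0 & at_coords T P (vec3 c 1 0).
Proof.
case/(cevian_foot_at T_unit Ae Be) => c c0; rewrite scale_vec3 => Pc.
exists c => //; congr (at_coords T P _): Pc.
by apply/rowP => i; rewrite !mxE; case: (ord3P i) => -> /=; ring.
Qed.

Lemma intersectionBC P L M b c :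
  has_equation T L (vec3 (- b) 0 1) -> has_equation T M (vec3 1 (- c) 0) ->
  is_intersection P L M -> at_coords T P (vec3 c 1 (b * c)).
Proof.
move=> Lb Mc /(is_intersection_at T_unit Lb Mc); apply.
- by rewrite vec3_eq0 oner_eq0 andbF.
- by apply/eqP; rewrite vec3_dot; apply/eqP; ring.
by apply/eqP; rewrite vec3_dot; apply/eqP; ring.
Qed.

Lemma intersectionAC P L M a c :
  has_equation T L (vec3 0 1 (- a)) -> has_equation T M (vec3 1 (- c) 0) ->
  is_intersection P L M -> at_coords T P (vec3 (c * a) a 1).
Proof.
move=> La Mc /(is_intersection_at T_unit La Mc); apply.
- by rewrite vec3_eq0 oner_eq0 !andbF.
- by apply/eqP; rewrite vec3_dot; apply/eqP; ring.
by apply/eqP; rewrite vec3_dot; apply/eqP; ring.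
Qed.

Lemma intersectionAB P L M a b :
  has_equation T L (vec3 0 1 (- a)) -> has_equation T M (vec3 (- b) 0 1) ->
  is_intersection P L M -> at_coords T P (vec3 1 (a * b) b).
Proof.
move=> La Mb /(is_intersection_at T_unit La Mb); apply.
- by rewrite vec3_eq0 oner_eq0.
- by apply/eqP; rewrite vec3_dot; apply/eqP; ring.
by apply/eqP; rewrite vec3_dot; apply/eqP; ring.
Qed.
End Cevians.

(** * Equivalence of the four conditions through the product of the six parameters *)

Theorem theorem1 (R : realType)
    (A B C A1 B1 C1 A2 B2 C2 : point R)
    (X1 Y1 Z1 X2 Y2 Z2 U1 V1 W1 : point R)
    (hABC : triangle A B C)
    (hA1 : cevian_foot B C A1) (hB1 : cevian_foot C A B1)
    (hC1 : cevian_foot A B C1)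
    (hA2 : cevian_foot B C A2) (hB2 : cevian_foot C A B2)
    (hC2 : cevian_foot A B C2)
    (hA12 : A1 <> A2) (hB12 : B1 <> B2) (hC12 : C1 <> C2)
    (hconc : concurrent (line A A1) (line B B1) (line C C1) <->
             concurrent (line A A2) (line B B2) (line C C2))
    (hX1 : is_intersection X1 (line B B1) (line C C1))
    (hY1 : is_intersection Y1 (line A A1) (line C C1))
    (hZ1 : is_intersection Z1 (line A A1) (line B B1))
    (hX2 : is_intersection X2 (line B B2) (line C C2))
    (hY2 : is_intersection Y2 (line A A2) (line C C2))
    (hZ2 : is_intersection Z2 (line A A2) (line B B2))
    (hU1 : is_intersection U1 (line B B1) (line C C2))
    (hV1 : is_intersection V1 (line C C1) (line A A2))
    (hW1 : is_intersection W1 (line A A1) (line B B2)) :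
  [<-> lie_on_conic [:: A1; A2; B1; B2; C1; C2];
       lie_on_conic [:: X1; X2; Y1; Y2; Z1; Z2];
       touch_conic [:: line A A1; line A A2; line B B1; line B B2;
                       line C C1; line C C2];
       meet_in_single_point (line A U1) (line B V1) (line C W1)].
Proof.
have two : 2 != 0 :> R by rewrite pnatr_eq0.
have one : 1 != 0 :> R := oner_neq0 R.
have [T [T_unit Ae Be Ce]] := triangle_frame hABC.
have [a1 a10 A1e] := footA T_unit Be Ce hA1.
have [a2 a20 A2e] := footA T_unit Be Ce hA2.
have [b1 b10 B1e] := footB T_unit Ae Ce hB1.
have [b2 b20 B2e] := footB T_unit Ae Ce hB2.
have [c1 c10 C1e] := footC T_unit Ae Be hC1.
have [c2 c20 C2e] := footC T_unit Ae Be hC2.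
have a12 : a1 != a2.
  by apply: contra_not_neq hA12 => a12; apply: at_coords_inj A1e _; rewrite a12.
have b12 : b1 != b2.
  by apply: contra_not_neq hB12 => b12; apply: at_coords_inj B1e _; rewrite b12.
have c12 : c1 != c2.
  by apply: contra_not_neq hC12 => c12; apply: at_coords_inj C1e _; rewrite c12.
have AA1 := cevian_equationA T_unit Ae one (esym (mulr1 a1)) A1e.
have AA2 := cevian_equationA T_unit Ae one (esym (mulr1 a2)) A2e.
have BB1 := cevian_equationB T_unit Be one (esym (mulr1 b1)) B1e.
have BB2 := cevian_equationB T_unit Be one (esym (mulr1 b2)) B2e.
have CC1 := cevian_equationC T_unit Ce one (esym (mulr1 c1)) C1e.
have CC2 := cevian_equationC T_unit Ce one (esym (mulr1 c2)) C2e.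
pose K := a1 * a2 * b1 * b2 * c1 * c2.
have feet : lie_on_conic [:: A1; A2; B1; B2; C1; C2] <-> K = 1.
  rewrite -[X in lie_on_conic X]/(unzip1 [:: (A1, vec3 0 a1 1); (A2, vec3 0 a2 1);
    (B1, vec3 1 0 b1); (B2, vec3 1 0 b2); (C1, vec3 c1 1 0); (C2, vec3 c2 1 0)]).
  rewrite (lie_on_conic_coords T_unit); last first.
    by move=> p; rewrite !inE => /or4P[|||/or3P[]] /eqP->.
  split=> [[Q QC Q0]|]; last exact: carnot_sufficient.
  have := carnot_necessary two _ _ _ _ _ _ QC Q0.
  by rewrite !mulr1 a10 a20 b10 b20 c10 c20 one; apply.
have vertices : lie_on_conic [:: X1; X2; Y1; Y2; Z1; Z2] <-> K = 1.
  rewrite -[X in lie_on_conic X]/(unzip1 [:: (X1, vec3 c1 1 (b1 * c1));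
    (X2, vec3 c2 1 (b2 * c2)); (Y1, vec3 (c1 * a1) a1 1); (Y2, vec3 (c2 * a2) a2 1);
    (Z1, vec3 1 (a1 * b1) b1); (Z2, vec3 1 (a2 * b2) b2)]).
  rewrite (lie_on_conic_coords T_unit); last first.
    move=> p; rewrite !inE => /or4P[|||/or3P[]] /eqP->;
      solve [exact: intersectionBC hX1|exact: intersectionBC hX2
            |exact: intersectionAC hY1|exact: intersectionAC hY2
            |exact: intersectionAB hZ1|exact: intersectionAB hZ2].
  split=> [[Q QC Q0]|]; last exact: six_points_sufficient.
  (* By [hconc] the triples are both concurrent, and then [K] is a product of two ones, or both
     non-concurrent, and then X1, Y1, Z1 form a basis. *)
  have [p1|p1] := eqVneq (a1 * b1 * c1) 1.
    have p2 : a2 * b2 * c2 = 1.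
      by apply/(concurrentE T_unit AA2 BB2 CC2)/hconc/(concurrentE T_unit AA1 BB1 CC1).
    by rewrite -[RHS]mulr1 -{1}p1 -p2 /K; ring.
  apply: (six_points_necessary two a12 b12 c12 p1 _ QC Q0).
  apply: contraNneq p1 => p2; apply/eqP.
  by apply/(concurrentE T_unit AA1 BB1 CC1)/hconc/(concurrentE T_unit AA2 BB2 CC2).
have tangents : touch_conic [:: line A A1; line A A2; line B B1; line B B2;
                       line C C1; line C C2] <-> K = 1.
  rewrite -[X in touch_conic X]/(unzip1 [:: (line A A1, vec3 0 1 (- a1));
    (line A A2, vec3 0 1 (- a2)); (line B B1, vec3 (- b1) 0 1);
    (line B B2, vec3 (- b2) 0 1); (line C C1, vec3 1 (- c1) 0);
    (line C C2, vec3 1 (- c2) 0)]).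
  rewrite (touch_conic_coords T_unit two); last first.
    by move=> p; rewrite !inE => /or4P[|||/or3P[]] /eqP->.
  split; last exact: dual_carnot_sufficient.
  (* Both kinds of touched conic yield a nonzero dual conic, so Carnot's theorem applies in the dual
     plane. *)
  move=> touch; have [S SC S0] : exists2 S : 'M[R]_3, conic S & vanishes_on S
     [:: vec3 0 1 (- a1); vec3 0 1 (- a2); vec3 (- b1) 0 1;
    vec3 (- b2) 0 1; vec3 1 (- c1) 0; vec3 1 (- c2) 0].
    case: touch => [[S [ST Su] S0]|[p [p' [p0 p'0]]]]; last exact: point_pair_conic.
    exists S => //; split=> //; apply: contraTneq Su => ->.
    by rewrite unitmxE det0 unitr0.
  (* Here the unprimed entries are 1 and the primed ones are the negated parameters; the six signs
     cancel. *)
  have := carnot_necessary two _ _ _ _ _ _ SC S0.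
  rewrite !oppr_eq0 a10 a20 b10 b20 c10 c20 one !mul1r !eqr_opp.
  rewrite ![_ == a1]eq_sym ![_ == b1]eq_sym ![_ == c1]eq_sym.
  by move/(_ erefl erefl erefl a12 b12 c12) => e; rewrite /K e; ring.
have single : meet_in_single_point (line A U1) (line B V1) (line C W1) <-> K = 1.
  have U1e := intersectionBC T_unit BB1 CC2 hU1.
  have V1e : at_coords T V1 (vec3 (c1 * a2) a2 1).
    by apply: (intersectionAC T_unit AA2 CC1); rewrite /is_intersection capvC.
  have W1e := intersectionAB T_unit AA1 BB2 hW1.
  have AU1 : has_equation T (line A U1) (vec3 0 1 (- (b1 * c2)^-1)).
    by apply: (cevian_equationA T_unit Ae _ _ U1e); rewrite ?mulVf ?mulf_neq0.
  have BV1 : has_equation T (line B V1) (vec3 (- (c1 * a2)^-1) 0 1).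
    by apply: (cevian_equationB T_unit Be _ _ V1e); rewrite ?mulVf ?mulf_neq0.
  have CW1 : has_equation T (line C W1) (vec3 1 (- (a1 * b2)^-1) 0).
    by apply: (cevian_equationC T_unit Ce _ _ W1e); rewrite ?mulVf ?mulf_neq0.
  rewrite (meet_in_single_pointE T_unit AU1 BV1 CW1).
  (* Each of the six parameters enters exactly one of the three lines, so the Ceva product is the
     inverse of [K]. *)
  have -> : (b1 * c2)^-1 * (c1 * a2)^-1 * (a1 * b2)^-1 = K^-1.
    by rewrite -!invfM /K; congr _^-1; ring.
  by split=> [/(congr1 GRing.inv)|->]; rewrite ?invrK invr1.
by tfae; [move/feet/vertices|move/vertices/tangents|move/tangents/single|move/single/feet].
Qed.
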